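(* Let $q$ be a nonzero complex number with $|q|<1$, and let $a,b$ be complex numbers with $b\neq 0$ and $\left|\frac{q^2}{b}\right|<1$. Assume that no zero denominators occur below, i.e. $q+b\neq 0$, $1+b\neq 0$, and none of $\frac{aq}{b},\ \frac{(a+b)q^2}{q+b},\ \frac{a+b}{1+b}$ is of the form $q^{-k}$ with $k\ge 0$ an integer. Then $${}_4\phi_3\!\left[\begin{matrix}a,\; b,\; \frac{a+b}{q+b},\; \frac{(a+b)q}{1+b}\\[2pt] \frac{aq}{b},\; \frac{(a+b)q^2}{q+b},\; \frac{a+b}{1+b}\end{matrix};q,-\frac{q^2}{b}\right] =\frac{q-aq+b-bq}{b}\;\frac{(-q;q)_\infty}{(-q/b;q)_\infty\,(aq/b;q)_\infty}\,(aq^2;q^2)_\infty\,(aq^3/b^2;q^2)_\infty .$$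
   Context: For a complex number $p$ with $|p|<1$ and complex $x$: $(x;p)_0=1$, $(x;p)_n=\prod_{k=0}^{n-1}(1-xp^k)$ for $n\ge1$, and $(x;p)_\infty=\prod_{k=0}^{\infty}(1-xp^k)$ (used with $p=q$ and $p=q^2$). The basic hypergeometric series is $${}_4\phi_3\!\left[\begin{matrix}a_1,a_2,a_3,a_4\\ b_1,b_2,b_3\end{matrix};q,x\right]=\sum_{n=0}^{\infty}\frac{(a_1;q)_n(a_2;q)_n(a_3;q)_n(a_4;q)_n}{(q;q)_n(b_1;q)_n(b_2;q)_n(b_3;q)_n}x^n .$$ *)

(* Defs.v *)
From Stdlib Require Import Reals.
From Coquelicot Require Import Coquelicot.
Open Scope C_scope.

(* (x;p)_n *)
Fixpoint qpoch (x p : C) (n : nat) : C :=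
  match n with
  | O => 1
  | S k => qpoch x p k * (1 - x * Cpow p k)
  end.

(* (x;p)_oo: Coquelicot's [lim] is total; it is the actual limit of the partial
   products when they converge, which is always the case for |p| < 1. *)
Definition qpoch_inf (x p : C) : C :=
  lim (T := C_CompleteNormedModule) (filtermap (qpoch x p) eventually).

(* n-th term of the series 4phi3[a1, a2, a3, a4; b1, b2, b3; q, x] *)
Definition phi43_term (a1 a2 a3 a4 b1 b2 b3 q x : C) (n : nat) : C :=
  (qpoch a1 q n * qpoch a2 q n * qpoch a3 q n * qpoch a4 q n) /
  (qpoch q q n * qpoch b1 q n * qpoch b2 q n * qpoch b3 q n) * Cpow x n.

(* The series 4phi3 converges in C, with sum s. *)
Definition is_phi43 (a1 a2 a3 a4 b1 b2 b3 q x s : C) : Prop :=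
  is_series (K := C_AbsRing) (V := C_NormedModule)
    (phi43_term a1 a2 a3 a4 b1 b2 b3 q x) s.

(* Main.v *)
Require Import Defs.
From Stdlib Require Import Reals.
From Coquelicot Require Import Coquelicot.
From Stdlib Require Import Lra Lia.
Open Scope C_scope.

(** Write z = -q/b, c = (a+b)/(q+b) and d = (a+b)/(1+b). In the 4phi3 series the
    parameters c and dq face cq^2 and d, so these four factorials reduce to a
    rational function of q^n. Partial fractions and a telescoping sum then turn
    the series into a constant multiple of the Bailey-Daum series
    2phi1(aq, b; aq^2/b; q, z), whose sum is known: this is [phi_telescope], and
    the constant is (q - aq + b - bq)/b divided by 1 - aq/b.

    The difficulty is convergence. The 4phi3 is a series in zq, and only
    |zq| < 1 is assumed, whereas the Bailey-Daum series is a series in z and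
    the boundary term of the telescoping sum is of order z^N; in general
    neither converges when |z| >= 1. Instead of continuing analytically from |z| < 1, all sums are
    taken in a generalized sense ([is_norlund_sum]): s is the sum of u when the
    partial sums satisfy S_(N+1) - z S_N -> (1-z) s. This agrees with the usual
    sum for convergent series, is linear, gives zero to telescoping sums with boundary
    z^(N+1) g_N ([is_norlund_sum_telescope]), and exists for terms z^n g_n, when
    g_(n+1) - g_n = O(q^n) and |zq| < 1 ([lag_dominated]). The condition
    q + b <> 0 says exactly that z <> 1, so that such a sum is unique.

    The Bailey-Daum summation itself ([bailey_daum]) is proved in that sense. Its
    sum L(A) satisfies a first-order recurrence under A -> Aq^2, again by a
    telescoping sum ([bailey_daum_telescope]). Iterating it reduces L(A) to L(0),
    by Tannery's theorem, and the generalized sum L(0) is an ordinary q-binomial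
    series with parameter b/q at zq ([bailey_daum_at_0]). The q-binomial theorem
    follows in the same way from its functional equation ([q_binomial]). *)

(** * Limits of complex sequences *)

(** Convergence is phrased through the modulus, because the filter limits on C
    seen as a normed module and as a ring with absolute value use different
    balls; real squeeze arguments then replace all filter reasoning. *)
Definition Clim (u : nat -> C) (l : C) : Prop :=
  is_lim_seq (fun n => Cmod (u n - l)) 0%R.

Lemma Clim_filterlim (u : nat -> C) (l : C) :
  Clim u l <-> filterlim u eventually (locally (T := C_UniformSpace) l).
Proof.
  pose proof (@filterlim_locally_ball_norm C_AbsRing nat C_NormedModule
    eventually _ u l) as H.
  split; intro h.
  - apply H. intro eps.
    apply is_lim_seq_spec in h. destruct (h eps) as [N hN].
    exists N. intros n hn. specialize (hN n hn).
    rewrite Rminus_0_r, Rabs_pos_eq in hN by apply Cmod_ge_0. exact hN.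
  - apply is_lim_seq_spec. intro eps.
    destruct (proj1 H h eps) as [N hN]. exists N. intros n hn.
    rewrite Rminus_0_r, Rabs_pos_eq by apply Cmod_ge_0. exact (hN n hn).
Qed.

Lemma Clim_squeeze (u : nat -> C) (l : C) (e : nat -> R) :
  (forall n, (Cmod (u n - l) <= e n)%R) -> is_lim_seq e 0%R -> Clim u l.
Proof.
  intros h he.
  apply is_lim_seq_le_le with (u := fun _ => 0%R) (w := e); trivial.
  - intro n. split; [apply Cmod_ge_0 | apply h].
  - apply is_lim_seq_const.
Qed.

Lemma Clim_unique (u : nat -> C) (l m : C) : Clim u l -> Clim u m -> l = m.
Proof.
  intros hl hm. apply Clim_filterlim in hl, hm.
  exact (@filterlim_locally_unique nat C_AbsRing C_NormedModule eventually _
           u l m hl hm).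
Qed.

Lemma Clim_ext (u v : nat -> C) (l : C) :
  (forall n, u n = v n) -> Clim u l -> Clim v l.
Proof.
  intros h. apply is_lim_seq_ext. intro n. now rewrite h.
Qed.

Lemma Clim_const (l : C) : Clim (fun _ => l) l.
Proof.
  apply is_lim_seq_ext with (fun _ => 0%R); [| apply is_lim_seq_const].
  intro n. replace (l - l) with (RtoC 0) by ring. now rewrite Cmod_0.
Qed.

Lemma Clim_subseq (u : nat -> C) (l : C) (phi : nat -> nat) :
  (forall n, (n <= phi n)%nat) -> Clim u l -> Clim (fun n => u (phi n)) l.
Proof.
  intros hphi h.
  apply (is_lim_seq_subseq (fun n => Cmod (u n - l)) 0%R phi); trivial.
  intros P [N hN]. exists N. intros n hn. apply hN.
  specialize (hphi n). lia.
Qed.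

Lemma Clim_incr (u : nat -> C) (l : C) :
  Clim (fun n => u (S n)) l <-> Clim u l.
Proof. symmetry. apply is_lim_seq_incr_1. Qed.

Lemma Clim_plus (u v : nat -> C) (l m : C) :
  Clim u l -> Clim v m -> Clim (fun n => u n + v n) (l + m).
Proof.
  intros hu hv.
  apply Clim_squeeze with (fun n => (Cmod (u n - l) + Cmod (v n - m))%R).
  - intro n. replace (u n + v n - (l + m)) with ((u n - l) + (v n - m)) by ring.
    apply Cmod_triangle.
  - replace (Finite 0) with (Finite (0 + 0)) by (f_equal; ring).
    now apply is_lim_seq_plus'.
Qed.

Lemma Clim_mult (u v : nat -> C) (l m : C) :
  Clim u l -> Clim v m -> Clim (fun n => u n * v n) (l * m).
Proof.
  intros hu hv.
  apply Clim_squeeze with (fun n =>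
    (Cmod (u n - l) * Cmod (v n - m) + Cmod l * Cmod (v n - m)
     + Cmod m * Cmod (u n - l))%R).
  - intro n.
    replace (u n * v n - l * m)
      with ((u n - l) * (v n - m) + l * (v n - m) + m * (u n - l)) by ring.
    rewrite <- !Cmod_mult.
    eapply Rle_trans; [apply Cmod_triangle |].
    apply Rplus_le_compat_r, Cmod_triangle.
  - replace (Finite 0)
      with (Finite (0 * 0 + Cmod l * 0 + Cmod m * 0)) by (f_equal; ring).
    repeat apply is_lim_seq_plus'; apply is_lim_seq_mult'; trivial;
      apply is_lim_seq_const.
Qed.

Lemma Clim_scal (c : C) (u : nat -> C) (l : C) :
  Clim u l -> Clim (fun n => c * u n) (c * l).
Proof. intro h. apply Clim_mult; [apply Clim_const | exact h]. Qed.

Lemma Clim_inv (u : nat -> C) (l : C) (B : R) :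
  (forall n, u n <> 0) -> l <> 0 -> (forall n, (Cmod (/ u n) <= B)%R) ->
  Clim u l -> Clim (fun n => / u n) (/ l).
Proof.
  intros h0 hl hB h.
  apply Clim_squeeze with (fun n => (B * Cmod (/ l) * Cmod (u n - l))%R).
  - intro n. replace (/ u n - / l) with (/ u n * / l * - (u n - l))
      by (field; now split).
    rewrite !Cmod_mult, Cmod_opp.
    apply Rmult_le_compat_r; [apply Cmod_ge_0 |].
    apply Rmult_le_compat_r; [apply Cmod_ge_0 | apply hB].
  - replace (Finite 0) with (Finite (B * Cmod (/ l) * 0)) by (f_equal; ring).
    apply is_lim_seq_mult'; [apply is_lim_seq_const | exact h].
Qed.

Lemma Clim_Cmod (u : nat -> C) (l : C) :
  Clim u l -> is_lim_seq (fun n => Cmod (u n)) (Cmod l).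
Proof.
  intro h. apply is_lim_seq_le_le with
    (u := fun n => (Cmod l - Cmod (u n - l))%R)
    (w := fun n => (Cmod l + Cmod (u n - l))%R).
  - intro n. split.
    + pose proof (Cmod_triangle (u n) (- (u n - l))) as H.
      replace (u n + - (u n - l)) with l in H by ring.
      rewrite Cmod_opp in H. lra.
    + pose proof (Cmod_triangle l (u n - l)) as H.
      replace (l + (u n - l)) with (u n) in H by ring. lra.
  - replace (Finite (Cmod l)) with (Finite (Cmod l - 0)) by (f_equal; ring).
    apply is_lim_seq_minus'; [apply is_lim_seq_const | exact h].
  - replace (Finite (Cmod l)) with (Finite (Cmod l + 0)) by (f_equal; ring).
    apply is_lim_seq_plus'; [apply is_lim_seq_const | exact h].
Qed.

(** Gives access to [qpoch_inf] and [Cseries], whose values are total limits. *)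
Lemma Clim_lim (u : nat -> C) (l : C) :
  Clim u l -> lim (T := C_CompleteNormedModule) (filtermap u eventually) = l.
Proof.
  intro h. apply Clim_filterlim in h.
  set (F := filtermap u eventually).
  assert (PF : ProperFilter F).
  { apply filtermap_proper_filter, eventually_filter. }
  assert (hc : forall eps : posreal,
             F (ball (lim (T := C_CompleteNormedModule) F) eps)).
  { apply (complete_cauchy (T := C_CompleteNormedModule) F PF).
    intro eps. exists l. apply h. now exists eps. }
  apply (@filterlim_locally_unique nat C_AbsRing C_NormedModule eventually _
           u); [| exact h].
  apply filterlim_locally. exact hc.
Qed.

Lemma Cpow_Clim (p : C) : (Cmod p < 1)%R -> Clim (fun n => Cpow p n) 0.
Proof.
  intro hp. apply Clim_squeeze with (fun n => (Cmod p ^ n)%R).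
  - intro n. replace (p ^ n - 0) with (p ^ n) by ring.
    rewrite Cmod_pow. apply Rle_refl.
  - apply is_lim_seq_geom. rewrite Rabs_pos_eq; [exact hp | apply Cmod_ge_0].
Qed.

(** * Dominated series and Tannery's theorem *)

Notation is_Cseries := (is_series (K := C_AbsRing) (V := C_NormedModule)).

Definition csum (u : nat -> C) (N : nat) : C := sum_n (G := C_AbelianMonoid) u N.

Definition Cseries (u : nat -> C) : C :=
  lim (T := C_CompleteNormedModule) (filtermap (csum u) eventually).

Lemma csum_0 (u : nat -> C) : csum u 0 = u O.
Proof. exact (sum_O (G := C_AbelianMonoid) u). Qed.

Lemma csum_S (u : nat -> C) (N : nat) : csum u (S N) = csum u N + u (S N).
Proof. exact (sum_Sn (G := C_AbelianMonoid) u N). Qed.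

Lemma is_Cseries_Clim (u : nat -> C) (s : C) : is_Cseries u s <-> Clim (csum u) s.
Proof. symmetry. apply Clim_filterlim. Qed.

Lemma csum_lin (c d : C) (u v : nat -> C) (N : nat) :
  csum (fun n => c * u n + d * v n) N = c * csum u N + d * csum v N.
Proof.
  induction N as [|N IH]; [rewrite !csum_0 | rewrite !csum_S, IH]; ring.
Qed.

Lemma is_Cseries_lin (c d : C) (u v : nat -> C) (s t : C) :
  is_Cseries u s -> is_Cseries v t ->
  is_Cseries (fun n => c * u n + d * v n) (c * s + d * t).
Proof.
  intros hu hv. apply is_Cseries_Clim in hu, hv. apply is_Cseries_Clim.
  apply Clim_ext with (fun N => c * csum u N + d * csum v N).
  - intro N. now rewrite csum_lin.
  - apply Clim_plus; now apply Clim_scal.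
Qed.

Lemma is_Cseries_unique (u : nat -> C) (s t : C) :
  is_Cseries u s -> is_Cseries u t -> s = t.
Proof. rewrite !is_Cseries_Clim. apply Clim_unique. Qed.

Lemma dominated_series (M r : R) (u : nat -> C) :
  (0 <= r < 1)%R -> (forall n, Cmod (u n) <= M * r ^ n)%R ->
  is_Cseries u (Cseries u).
Proof.
  intros hr h.
  destruct (ex_series_le (K := C_AbsRing) (V := C_CompleteNormedModule)
              u (fun n => M * r ^ n)%R) as [s hs].
  - exact h.
  - apply (ex_series_scal (K := R_AbsRing) (V := R_NormedModule) M).
    apply ex_series_geom. rewrite Rabs_pos_eq; lra.
  - assert (hc : Clim (csum u) s) by (now apply is_Cseries_Clim).
    unfold Cseries. rewrite (Clim_lim _ _ hc). exact hs.
Qed.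

(** A tail bound depending on the dominating series only, hence uniform over
    any family dominated by it. *)
Lemma dominated_tail (M r : R) (u : nat -> C) (s : C) (N : nat) :
  (0 <= r < 1)%R -> (forall n, Cmod (u n) <= M * r ^ n)%R ->
  is_Cseries u s -> (Cmod (s - csum u N) <= M * r ^ S N / (1 - r))%R.
Proof.
  intros hr h hs. apply is_Cseries_Clim in hs.
  assert (hk : forall k,
    (Cmod (csum u (k + N) - csum u N) <= M * r ^ S N * (1 - r ^ k) / (1 - r))%R).
  { induction k as [|k IH].
    - simpl (0 + N)%nat. replace (csum u N - csum u N) with (RtoC 0) by ring.
      rewrite Cmod_0. right. simpl. field. lra.
    - simpl (S k + N)%nat. rewrite csum_S.
      replace (csum u (k + N) + u (S (k + N)) - csum u N)
        with ((csum u (k + N) - csum u N) + u (S (k + N))) by ring.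
      eapply Rle_trans; [apply Cmod_triangle |].
      eapply Rle_trans; [apply Rplus_le_compat; [exact IH | apply h] |].
      right. replace (S (k + N)) with (S N + k)%nat by lia.
      rewrite pow_add. simpl. field. lra. }
  assert (hM : (0 <= M)%R).
  { specialize (h O). simpl in h. pose proof (Cmod_ge_0 (u O)). lra. }
  assert (hrN : (0 <= r ^ S N)%R) by (apply pow_le; lra).
  assert (hlim : is_lim_seq (fun k => Cmod (csum u (k + N) - csum u N))
                   (Cmod (s - csum u N))).
  { apply Clim_Cmod. apply Clim_plus; [| apply Clim_const].
    apply (Clim_subseq (csum u) s (fun k => (k + N)%nat)); [lia | exact hs]. }
  apply (is_lim_seq_le (fun k => Cmod (csum u (k + N) - csum u N))
           (fun _ => (M * r ^ S N / (1 - r))%R)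
           (Cmod (s - csum u N)) (M * r ^ S N / (1 - r))%R);
    [| exact hlim | apply is_lim_seq_const].
  intro k. eapply Rle_trans; [apply hk |].
  apply Rmult_le_compat_r; [left; apply Rinv_0_lt_compat; lra |].
  assert (0 <= r ^ k)%R by (apply pow_le; lra).
  assert (0 <= M * r ^ S N)%R by (now apply Rmult_le_pos).
  nra.
Qed.

Lemma Tannery (M r : R) (f : nat -> nat -> C) (g : nat -> C)
  (F : nat -> C) (s : C) :
  (0 <= r < 1)%R -> (forall m n, Cmod (f m n) <= M * r ^ n)%R ->
  (forall n, Clim (fun m => f m n) (g n)) ->
  (forall m, is_Cseries (f m) (F m)) -> is_Cseries g s -> Clim F s.
Proof.
  intros hr hf hlim hS hs.
  assert (hg : forall n, (Cmod (g n) <= M * r ^ n)%R).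
  { intro n. apply (is_lim_seq_le (fun m => Cmod (f m n)) (fun _ => (M * r ^ n)%R)
      (Cmod (g n)) (M * r ^ n)%R).
    - intro m. apply hf.
    - now apply Clim_Cmod.
    - apply is_lim_seq_const. }
  apply is_lim_seq_spec. intro eps.
  (* Two tails below eps/3, and the finite sums up to the same N. *)
  assert (ht : is_lim_seq (fun N => M * r ^ S N / (1 - r))%R 0%R).
  { replace (Finite 0) with (Finite (M * 0 * / (1 - r))) by (f_equal; ring).
    apply is_lim_seq_mult'; [| apply is_lim_seq_const].
    apply is_lim_seq_mult'; [apply is_lim_seq_const |].
    apply -> (is_lim_seq_incr_1 (fun N => (r ^ N)%R)).
    apply is_lim_seq_geom. rewrite Rabs_pos_eq; lra. }
  apply is_lim_seq_spec in ht.
  assert (he : (0 < eps / 3)%R) by (destruct eps as [e he]; simpl; lra).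
  destruct (ht (mkposreal _ he)) as [N hN].
  specialize (hN N (Nat.le_refl N)). simpl in hN.
  apply Rabs_def2 in hN. destruct hN as [hN _].
  assert (hfin : Clim (fun m => csum (f m) N) (csum g N)).
  { clear hN. induction N as [|N IH].
    - apply Clim_ext with (fun m => f m O).
      + intro m. now rewrite csum_0.
      + rewrite csum_0. apply hlim.
    - apply Clim_ext with (fun m => csum (f m) N + f m (S N)).
      + intro m. now rewrite csum_S.
      + rewrite csum_S. now apply Clim_plus. }
  apply is_lim_seq_spec in hfin.
  destruct (hfin (mkposreal _ he)) as [m0 hm0].
  exists m0. intros m hm. specialize (hm0 m hm). simpl in hm0.
  rewrite Rminus_0_r in *. rewrite Rabs_pos_eq in * by apply Cmod_ge_0.
  pose proof (dominated_tail M r (f m) (F m) N hr (hf m) (hS m)) as h1.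
  pose proof (dominated_tail M r g s N hr hg hs) as h2.
  replace (F m - s) with ((F m - csum (f m) N) + (csum (f m) N - csum g N)
     + - (s - csum g N)) by ring.
  eapply Rle_lt_trans; [apply Cmod_triangle |]. rewrite Cmod_opp.
  pose proof (Cmod_triangle (F m - csum (f m) N) (csum (f m) N - csum g N)).
  simpl in *. lra.
Qed.

(** * Sequences of geometric variation *)

(** Families of sequences that are bounded and whose increments are O(r^n),
    uniformly in the index. This is the regularity that makes the sequence
    z^n u_n summable in the sense of [is_norlund_sum] as soon as |z| r < 1, and it is
    stable under products and under reciprocals bounded away from poles; every
    quotient of q-shifted factorials below has it with r = |q|. *)
Definition geovar {I : Type} (r : R) (u : I -> nat -> C) : Prop :=
  exists M : R, forall i n,
    (Cmod (u i n) <= M /\ Cmod (u i (S n) - u i n) <= M * r ^ n)%R.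

Lemma geovar_ext {I : Type} (r : R) (u v : I -> nat -> C) :
  (forall i n, u i n = v i n) -> geovar r u -> geovar r v.
Proof.
  intros h [M hM]. exists M. intros i n. rewrite <- !h. apply hM.
Qed.

Lemma geovar_mult {I : Type} (r : R) (u v : I -> nat -> C) :
  (0 <= r)%R -> geovar r u -> geovar r v -> geovar r (fun i n => u i n * v i n).
Proof.
  intros hr [M hM] [N hN]. exists (2 * M * N)%R. intros i n.
  destruct (hM i n) as [u0 du], (hN i n) as [v0 dv].
  destruct (hM i (S n)) as [u1 _].
  pose proof (Cmod_ge_0 (u i n)). pose proof (Cmod_ge_0 (v i n)).
  pose proof (Cmod_ge_0 (u i (S n))).
  pose proof (Cmod_ge_0 (u i (S n) - u i n)).
  pose proof (Cmod_ge_0 (v i (S n) - v i n)).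
  split.
  - rewrite Cmod_mult.
    assert (Cmod (u i n) * Cmod (v i n) <= M * N)%R
      by (apply Rmult_le_compat; lra).
    assert (0 <= M * N)%R by (apply Rmult_le_pos; lra). lra.
  - replace (u i (S n) * v i (S n) - u i n * v i n)
      with (u i (S n) * (v i (S n) - v i n) + (u i (S n) - u i n) * v i n) by ring.
    eapply Rle_trans; [apply Cmod_triangle |]. rewrite !Cmod_mult.
    replace (2 * M * N * r ^ n)%R
      with (M * (N * r ^ n) + (M * r ^ n) * N)%R by ring.
    apply Rplus_le_compat; apply Rmult_le_compat; lra.
Qed.

Lemma geovar_inv {I : Type} (r B : R) (u : I -> nat -> C) :
  (0 <= r)%R -> (forall i n, u i n <> 0) ->
  (forall i n, (Cmod (/ u i n) <= B)%R) ->
  geovar r u -> geovar r (fun i n => / u i n).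
Proof.
  intros hr h0 hB [M hM]. exists (Rmax B (B * M * B)). intros i n. split.
  - eapply Rle_trans; [apply hB | apply Rmax_l].
  - destruct (hM i n) as [_ du].
    replace (/ u i (S n) - / u i n)
      with (/ u i (S n) * - (u i (S n) - u i n) * / u i n) by (field; split; apply h0).
    rewrite !Cmod_mult, Cmod_opp.
    assert (hrn : (0 <= r ^ n)%R) by now apply pow_le.
    apply Rle_trans with (B * M * B * r ^ n)%R.
    + replace (B * M * B * r ^ n)%R with (B * (M * r ^ n) * B)%R by ring.
      pose proof (Cmod_ge_0 (/ u i (S n))). pose proof (Cmod_ge_0 (/ u i n)).
      pose proof (Cmod_ge_0 (u i (S n) - u i n)).
      pose proof (hB i (S n)). pose proof (hB i n).
      apply Rmult_le_compat; try lra.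
      * apply Rmult_le_pos; lra.
      * apply Rmult_le_compat; lra.
    + apply Rmult_le_compat_r; [lra | apply Rmax_r].
Qed.

Lemma geovar_incr {I : Type} (r : R) (u : I -> nat -> C) :
  (0 <= r < 1)%R -> geovar r u -> geovar r (fun i n => u i (S n)).
Proof.
  intros hr [M hM]. exists M. intros i n. split; [apply hM |].
  destruct (hM i (S n)) as [h0 h1]. eapply Rle_trans; [exact h1 |].
  pose proof (Cmod_ge_0 (u i (S n))).
  assert (0 <= r ^ n)%R by (apply pow_le; lra).
  simpl. apply Rmult_le_compat_l; nra.
Qed.

Lemma geovar_Clim (r : R) (u : nat -> C) :
  (0 <= r < 1)%R -> geovar r (fun (_ : unit) n => u n) -> exists l, Clim u l.
Proof.
  intros hr [M hM].
  set (d := fun n => u (S n) - u n).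
  assert (hd : is_Cseries d (Cseries d)).
  { apply (dominated_series M r); trivial. intro n. apply (hM tt n). }
  exists (u O + Cseries d). apply Clim_incr.
  apply Clim_ext with (fun n => u O + csum d n).
  - intro n. induction n as [|n IH].
    + rewrite csum_0. unfold d. ring.
    + rewrite csum_S. replace (u O + (csum d n + d (S n)))
        with ((u O + csum d n) + d (S n)) by ring.
      rewrite IH. unfold d. ring.
  - apply Clim_plus; [apply Clim_const |]. now apply is_Cseries_Clim.
Qed.

(** * Finite and infinite q-shifted factorials *)

Lemma qpoch_add (x p : C) (m n : nat) :
  qpoch x p (m + n) = qpoch x p m * qpoch (x * Cpow p m) p n.
Proof.
  induction n as [|n IH].
  - rewrite Nat.add_0_r. simpl. ring.
  - rewrite Nat.add_succ_r. simpl. rewrite IH, Cpow_add_r. ring.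
Qed.

Lemma qpoch_Sl (x p : C) (n : nat) :
  qpoch x p (S n) = (1 - x) * qpoch (x * p) p n.
Proof.
  change (S n) with (1 + n)%nat. rewrite qpoch_add.
  simpl. rewrite !Cmult_1_r. ring.
Qed.

Lemma qpoch_ratio (x p : C) (n : nat) :
  qpoch (x * p) p n * (1 - x) = qpoch x p n * (1 - x * Cpow p n).
Proof.
  change (qpoch x p n * (1 - x * p ^ n)) with (qpoch x p (S n)).
  rewrite qpoch_Sl. ring.
Qed.

Lemma qpoch_0_l (p : C) (n : nat) : qpoch 0 p n = 1.
Proof. induction n as [|n IH]; simpl; [| rewrite IH]; ring. Qed.

Lemma one_minus_geom_neq0 (x p : C) (k : nat) :
  (Cmod x < 1)%R -> (Cmod p < 1)%R -> 1 - x * Cpow p k <> 0.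
Proof.
  intros hx hp e.
  assert (e' : x * p ^ k = 1).
  { replace (x * p ^ k) with (1 - (1 - x * p ^ k)) by ring. rewrite e. ring. }
  apply (f_equal Cmod) in e'. rewrite Cmod_mult, Cmod_pow, Cmod_1 in e'.
  pose proof (Cmod_ge_0 p). pose proof (Cmod_ge_0 x).
  assert (Cmod p ^ k <= 1)%R by (rewrite <- (pow1 k); apply pow_incr; lra).
  assert (0 <= Cmod p ^ k)%R by now apply pow_le.
  nra.
Qed.

Lemma pole_free (x p : C) :
  p <> 0 -> (forall k, x <> / Cpow p k) -> forall k, 1 - x * Cpow p k <> 0.
Proof.
  intros hp h k e. apply (h k). pose proof (Cpow_nz p k hp) as hpk.
  replace x with ((1 - (1 - x * p ^ k)) * / p ^ k) by (field; exact hpk).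
  rewrite e. ring.
Qed.

Lemma qpoch_neq0 (x p : C) (n : nat) :
  (forall k, 1 - x * Cpow p k <> 0) -> qpoch x p n <> 0.
Proof.
  intro h. induction n as [|n IH]; simpl.
  - intro e. injection e. lra.
  - now apply Cmult_neq_0.
Qed.

Lemma qpoch_continuous (u : nat -> C) (x p : C) (n : nat) :
  Clim u x -> Clim (fun m => qpoch (u m) p n) (qpoch x p n).
Proof.
  intro h. induction n as [|n IH]; simpl; [apply Clim_const |].
  apply Clim_mult; [exact IH |].
  replace (1 - x * p ^ n) with (1 + - p ^ n * x) by ring.
  apply Clim_ext with (fun m => 1 + - p ^ n * u m); [intro m; ring |].
  apply Clim_plus; [apply Clim_const | now apply Clim_scal].
Qed.

(** Each factor is estimated by 1 + y <= exp y, and the exponents K r^k sum up. *)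
Lemma product_bound (K r : R) (u : nat -> R) :
  (0 <= r < 1)%R -> (0 <= K)%R -> (u O <= 1)%R -> (forall n, (0 <= u n)%R) ->
  (forall n, (u (S n) <= u n * (1 + K * r ^ n))%R) ->
  forall n, (u n <= exp (K / (1 - r)))%R.
Proof.
  intros hr hK h0 hpos hS n.
  (* The bound with the partial geometric sum 1 + r + ... + r^(n-1) in place of
     the full one is what goes through the induction. *)
  apply Rle_trans with (exp (K * (1 - r ^ n) / (1 - r))).
  - induction n as [|n IH].
    + simpl. replace (K * (1 - 1) / (1 - r))%R with 0%R by (field; lra).
      rewrite exp_0. exact h0.
    + replace (K * (1 - r ^ S n) / (1 - r))%R
        with (K * (1 - r ^ n) / (1 - r) + K * r ^ n)%R by (simpl; field; lra).
      rewrite exp_plus. eapply Rle_trans; [apply hS |].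
      assert (0 <= K * r ^ n)%R
        by (apply Rmult_le_pos; [lra | apply pow_le; lra]).
      apply Rmult_le_compat; [apply hpos | lra | exact IH | apply exp_ineq1_le].
  - assert (0 <= r ^ n)%R by (apply pow_le; lra).
    assert (h : (K * (1 - r ^ n) / (1 - r) <= K / (1 - r))%R).
    { apply Rmult_le_compat_r; [left; apply Rinv_0_lt_compat; lra | nra]. }
    destruct h as [h | h]; [left; now apply exp_increasing | right; now rewrite h].
Qed.

Lemma qpoch_geovar {I : Type} (p : C) (x : I -> C) (X : R) :
  (Cmod p < 1)%R -> (forall i, (Cmod (x i) <= X)%R) ->
  geovar (Cmod p) (fun i n => qpoch (x i) p n).
Proof.
  intros hp hX.
  pose proof (Cmod_ge_0 p) as hp0.
  set (B := exp (Rabs X / (1 - Cmod p))).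
  assert (hB0 : (0 < B)%R) by apply exp_pos.
  assert (hx : forall i n, (Cmod (x i * Cpow p n) <= Rabs X * Cmod p ^ n)%R).
  { intros i n. rewrite Cmod_mult, Cmod_pow.
    apply Rmult_le_compat_r; [now apply pow_le |].
    eapply Rle_trans; [apply hX | apply Rle_abs]. }
  assert (hB : forall i n, (Cmod (qpoch (x i) p n) <= B)%R).
  { intro i. apply product_bound; try lra.
    - apply Rabs_pos.
    - simpl. rewrite Cmod_1. lra.
    - intro n. apply Cmod_ge_0.
    - intro n. simpl. rewrite Cmod_mult.
      apply Rmult_le_compat_l; [apply Cmod_ge_0 |].
      unfold Cminus. eapply Rle_trans; [apply Cmod_triangle |].
      rewrite Cmod_1, Cmod_opp. specialize (hx i n). lra. }
  exists (Rmax B (B * Rabs X)). intros i n. split.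
  - eapply Rle_trans; [apply hB | apply Rmax_l].
  - simpl.
    replace (qpoch (x i) p n * (1 - x i * p ^ n) - qpoch (x i) p n)
      with (- (qpoch (x i) p n * (x i * p ^ n))) by ring.
    rewrite Cmod_opp, Cmod_mult.
    apply Rle_trans with (B * Rabs X * Cmod p ^ n)%R.
    + rewrite Rmult_assoc.
      apply Rmult_le_compat; try apply Cmod_ge_0; [apply hB | apply hx].
    + apply Rmult_le_compat_r; [now apply pow_le | apply Rmax_r].
Qed.

Lemma geovar_qpoch {I : Type} (x p : C) :
  (Cmod p < 1)%R -> geovar (Cmod p) (fun (_ : I) n => qpoch x p n).
Proof.
  intro hp. apply (qpoch_geovar p (fun _ => x) (Cmod x)); trivial.
  intros _. apply Rle_refl.
Qed.

Lemma qpoch_Clim (x p : C) :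
  (Cmod p < 1)%R -> Clim (qpoch x p) (qpoch_inf x p).
Proof.
  intro hp. destruct (geovar_Clim (Cmod p) (qpoch x p)) as [l hl].
  - split; [apply Cmod_ge_0 | exact hp].
  - apply (qpoch_geovar p (fun _ : unit => x) (Cmod x)); trivial.
    intros _. apply Rle_refl.
  - unfold qpoch_inf. now rewrite (Clim_lim _ _ hl).
Qed.

Lemma qpoch_inf_Sl (x p : C) :
  (Cmod p < 1)%R -> qpoch_inf x p = (1 - x) * qpoch_inf (x * p) p.
Proof.
  intro hp. apply (Clim_unique (fun n => qpoch x p (S n))).
  - apply (proj2 (Clim_incr (qpoch x p) _)). now apply qpoch_Clim.
  - apply Clim_ext with (fun n => (1 - x) * qpoch (x * p) p n).
    + intro n. now rewrite qpoch_Sl.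
    + apply Clim_scal. now apply qpoch_Clim.
Qed.

(** A convergent product without zero factors does not tend to 0: its reciprocals
    satisfy a recursion of the same kind as the factorials themselves, since
    the factors 1 - x p^n tend to 1 and so are bounded away from 0. *)
Lemma qpoch_inv_bounded (x p : C) :
  (Cmod p < 1)%R -> (forall k, 1 - x * Cpow p k <> 0) ->
  exists B : R, forall n, (Cmod (/ qpoch x p n) <= B)%R.
Proof.
  intros hp h.
  pose proof (Cmod_ge_0 p) as hp0.
  assert (hD : exists D : R, (0 < D)%R /\
                 forall n, (Cmod (/ (1 - x * Cpow p n)) <= D)%R).
  { destruct (maj_by_pos (fun n => / Cmod (1 - x * Cpow p n))%R) as [D [hD hn]].
    - exists (/ 1)%R. apply is_lim_seq_Reals.
      apply is_lim_seq_inv with (l := Finite 1); [| injection; lra].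
      assert (hl : Clim (fun n => 1 - x * Cpow p n) (1 + (- x) * 0)).
      { apply Clim_ext with (fun n => 1 + (- x) * Cpow p n); [intro n; ring |].
        apply Clim_plus; [apply Clim_const |]. apply Clim_scal.
        now apply Cpow_Clim. }
      apply Clim_Cmod in hl.
      replace (1 + - x * 0) with (RtoC 1) in hl by ring.
      rewrite Cmod_1 in hl. exact hl.
    - exists D. split; [exact hD |]. intro n. rewrite Cmod_inv by apply h.
      eapply Rle_trans; [apply Rle_abs | apply hn]. }
  destruct hD as [D [hD0 hD]].
  exists (exp (D * Cmod x / (1 - Cmod p))). apply product_bound; try lra.
  - apply Rmult_le_pos; [lra | apply Cmod_ge_0].
  - simpl. replace (/ 1) with (RtoC 1) by field. rewrite Cmod_1. lra.
  - intro n. apply Cmod_ge_0.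
  - intro n. simpl.
    pose proof (h n) as hn. pose proof (qpoch_neq0 x p n h) as hq.
    (* 1/(1-y) = 1 + y/(1-y) puts the reciprocal in the form of product_bound. *)
    replace (/ (qpoch x p n * (1 - x * p ^ n)))
      with (/ qpoch x p n * (1 + / (1 - x * p ^ n) * (x * p ^ n)))
      by (field; now split).
    rewrite Cmod_mult. apply Rmult_le_compat_l; [apply Cmod_ge_0 |].
    eapply Rle_trans; [apply Cmod_triangle |].
    rewrite Cmod_1, !Cmod_mult, Cmod_pow.
    specialize (hD n).
    assert (0 <= Cmod x * Cmod p ^ n)%R
      by (apply Rmult_le_pos; [apply Cmod_ge_0 | now apply pow_le]).
    nra.
Qed.

Lemma qpoch_inf_neq0 (x p : C) :
  (Cmod p < 1)%R -> (forall k, 1 - x * Cpow p k <> 0) -> qpoch_inf x p <> 0.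
Proof.
  intros hp h e. destruct (qpoch_inv_bounded x p hp h) as [B hB].
  pose proof (qpoch_Clim x p hp) as hl. rewrite e in hl.
  apply Clim_Cmod in hl. rewrite Cmod_0 in hl.
  assert (H : Rbar_le 1%R (Finite (B * 0))).
  { apply (is_lim_seq_le (fun _ => 1%R) (fun n => B * Cmod (qpoch x p n))%R).
    - intro n. rewrite <- Cmod_1.
      replace (RtoC 1) with (/ qpoch x p n * qpoch x p n)
        by (apply Cinv_l, qpoch_neq0, h).
      rewrite Cmod_mult. apply Rmult_le_compat_r; [apply Cmod_ge_0 | apply hB].
    - apply is_lim_seq_const.
    - apply is_lim_seq_mult'; [apply is_lim_seq_const | exact hl]. }
  simpl in H. lra.
Qed.

(** Uniformity over the shifts x p^j is what allows a limit along them under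
    the summation sign. *)
Lemma qpoch_inv_geovar {I : Type} (x p : C) (j : I -> nat) :
  (Cmod p < 1)%R -> (forall k, 1 - x * Cpow p k <> 0) ->
  geovar (Cmod p) (fun i n => / qpoch (x * Cpow p (j i)) p n).
Proof.
  intros hp h. destruct (qpoch_inv_bounded x p hp h) as [B hB].
  pose proof (Cmod_ge_0 p) as hp0.
  destruct (qpoch_geovar p (fun _ : unit => x) (Cmod x) hp) as [M hM].
  { intros _. apply Rle_refl. }
  (* 1/(x p^j; p)_n = (x; p)_j / (x; p)_{j+n}: bounds for x alone serve every j. *)
  assert (hj : forall i k, 1 - x * Cpow p (j i) * Cpow p k <> 0).
  { intros i k. rewrite <- Cmult_assoc, <- Cpow_add_r. apply h. }
  apply (geovar_inv (Cmod p) (M * B)); trivial.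
  - intros i n. apply qpoch_neq0, hj.
  - intros i n.
    replace (/ qpoch (x * p ^ j i) p n)
      with (qpoch x p (j i) * / qpoch x p (j i + n)).
    + rewrite Cmod_mult.
      apply Rmult_le_compat; try apply Cmod_ge_0; [apply (hM tt) | apply hB].
    + rewrite qpoch_add. field.
      split; apply qpoch_neq0; [apply hj | apply h].
  - apply qpoch_geovar with (Cmod x); trivial. intro i.
    rewrite Cmod_mult, Cmod_pow. rewrite <- (Rmult_1_r (Cmod x)) at 2.
    apply Rmult_le_compat_l; [apply Cmod_ge_0 |].
    rewrite <- (pow1 (j i)). apply pow_incr. lra.
Qed.

Lemma geovar_qpoch_inv {I : Type} (x p : C) :
  (Cmod p < 1)%R -> (forall k, 1 - x * Cpow p k <> 0) ->
  geovar (Cmod p) (fun (_ : I) n => / qpoch x p n).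
Proof.
  intros hp h.
  apply geovar_ext with (fun (_ : I) n => / qpoch (x * Cpow p 0) p n).
  - intros _ n. simpl. now rewrite Cmult_1_r.
  - now apply qpoch_inv_geovar.
Qed.

(** * The q-binomial theorem *)

Definition qbin_term (b q y : C) (n : nat) : C :=
  qpoch b q n / qpoch q q n * Cpow y n.

Lemma qbin_coeff_geovar (b q : C) :
  (Cmod q < 1)%R ->
  geovar (Cmod q) (fun (_ : unit) n => qpoch b q n * / qpoch q q n).
Proof.
  intro hq. apply geovar_mult; [apply Cmod_ge_0 | now apply geovar_qpoch |].
  apply geovar_qpoch_inv; trivial. intro k. now apply one_minus_geom_neq0.
Qed.

(** The functional equation (1 - y) F(y) = (1 - b y) F(y q) of the binomial
    series, at the level of partial sums, where the boundary term is explicit. *)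
Lemma qbin_telescope (b q y : C) (N : nat) :
  (Cmod q < 1)%R ->
  csum (fun n => (1 - y) * qbin_term b q y n
                 + - (1 - b * y) * qbin_term b q (y * q) n) N
  = - y * (qpoch b q (S N) / qpoch q q N * Cpow y N).
Proof.
  intro hq.
  assert (h : forall k, 1 - q * Cpow q k <> 0) by (intro k; now apply one_minus_geom_neq0).
  induction N as [|N IH].
  - rewrite csum_0. unfold qbin_term. simpl. field.
  - rewrite csum_S, IH. unfold qbin_term.
    pose proof (h N) as hN. pose proof (qpoch_neq0 q q N h) as hQ.
    rewrite Cpow_mult_l. simpl qpoch. rewrite !Cpow_S. field. now split.
Qed.

(** Iterating the functional equation gives (y;q)_m F(y) = (by;q)_m F(y q^m),
    and F(y q^m) tends to F(0) = 1. The value is stated without dividing by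
    (y;q)_oo. *)
Lemma q_binomial (b q y : C) :
  (Cmod q < 1)%R -> (Cmod y < 1)%R ->
  exists s : C, is_Cseries (qbin_term b q y) s /\
            s * qpoch_inf y q = qpoch_inf (b * y) q.
Proof.
  intros hq hy.
  pose proof (Cmod_ge_0 q) as hq0. pose proof (Cmod_ge_0 y) as hy0.
  destruct (qbin_coeff_geovar b q hq) as [M hM].
  set (Y := fun m => y * Cpow q m).
  assert (hY : forall m, (Cmod (Y m) <= Cmod y)%R).
  { intro m. unfold Y. rewrite Cmod_mult, Cmod_pow.
    rewrite <- (Rmult_1_r (Cmod y)) at 2. apply Rmult_le_compat_l; [lra |].
    rewrite <- (pow1 m). apply pow_incr. lra. }
  assert (hdom : forall m n, (Cmod (qbin_term b q (Y m) n) <= M * Cmod y ^ n)%R).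
  { intros m n. unfold qbin_term. rewrite Cmod_mult, Cmod_pow.
    apply Rmult_le_compat; try apply Cmod_ge_0.
    - apply pow_le, Cmod_ge_0.
    - apply (hM tt n).
    - apply pow_incr. split; [apply Cmod_ge_0 | apply hY]. }
  set (F := fun m => Cseries (qbin_term b q (Y m))).
  assert (hF : forall m, is_Cseries (qbin_term b q (Y m)) (F m)).
  { intro m. apply (dominated_series M (Cmod y)); [lra | apply hdom]. }
  assert (hrec : forall m, (1 - Y m) * F m = (1 - b * Y m) * F (S m)).
  { intro m.
    assert (h : (1 - Y m) * F m + - (1 - b * Y m) * F (S m) = 0).
    { eapply is_Cseries_unique.
      - apply is_Cseries_lin; apply hF.
      - apply is_Cseries_Clim.
        assert (EY : Y (S m) = Y m * q) by (unfold Y; rewrite Cpow_S; ring).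
        rewrite EY.
        apply Clim_ext with
          (fun N => - Y m * ((qpoch b q N * / qpoch q q N)
                             * (1 - b * Cpow q N) * Cpow (Y m) N)).
        + intro N. rewrite qbin_telescope by exact hq. simpl. unfold Cdiv. ring.
        + destruct (geovar_Clim (Cmod q) (fun n => qpoch b q n * / qpoch q q n))
            as [l hl]; [lra | now apply qbin_coeff_geovar |].
          replace (RtoC 0) with (- Y m * (l * (1 + - b * 0) * 0)) by ring.
          apply Clim_scal, Clim_mult; [apply Clim_mult; [exact hl |] |].
          * apply Clim_ext with (fun N => 1 + - b * Cpow q N); [intro N; ring |].
            apply Clim_plus; [apply Clim_const | apply Clim_scal; now apply Cpow_Clim].
          * apply Cpow_Clim. specialize (hY m). lra. }
    replace ((1 - Y m) * F m)
      with ((1 - Y m) * F m + - (1 - b * Y m) * F (S m) + (1 - b * Y m) * F (S m)) by ring.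
    rewrite h. ring. }
  exists (F O). split.
  { specialize (hF O). unfold Y in hF at 1. simpl in hF.
    rewrite Cmult_1_r in hF. exact hF. }
  assert (hprod : forall m, F O * qpoch y q m = qpoch (b * y) q m * F m).
  { induction m as [|m IH]; simpl; [ring |].
    replace (F O * (qpoch y q m * (1 - y * q ^ m)))
      with ((F O * qpoch y q m) * (1 - y * q ^ m)) by ring.
    rewrite IH. specialize (hrec m). unfold Y in hrec.
    replace (qpoch (b * y) q m * F m * (1 - y * q ^ m))
      with (qpoch (b * y) q m * ((1 - y * q ^ m) * F m)) by ring.
    rewrite hrec. ring. }
  assert (hF1 : Clim F 1).
  { apply (Tannery M (Cmod y) (fun m => qbin_term b q (Y m)) (qbin_term b q 0));
      trivial; [now split | |].
    - intro n. unfold qbin_term. apply Clim_scal.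
      assert (hY0 : Clim Y 0).
      { replace (RtoC 0) with (y * 0) by ring. apply Clim_scal. now apply Cpow_Clim. }
      induction n as [|n IH]; [exact (Clim_const 1) |].
      rewrite Cpow_S. apply Clim_ext with (fun m => Y m * Cpow (Y m) n).
      + intro m. now rewrite Cpow_S.
      + now apply Clim_mult.
    - apply is_Cseries_Clim. apply Clim_ext with (fun _ => RtoC 1); [| apply Clim_const].
      intro N. induction N as [|N IH].
      + rewrite csum_0. unfold qbin_term. simpl. field.
      + rewrite csum_S, <- IH. unfold qbin_term. rewrite Cpow_S. ring. }
  apply (Clim_unique (fun m => F O * qpoch y q m)).
  - apply Clim_scal. now apply qpoch_Clim.
  - apply Clim_ext with (fun m => qpoch (b * y) q m * F m).
    + intro m. now rewrite hprod.
    + rewrite <- (Cmult_1_r (qpoch_inf (b * y) q)).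
      apply Clim_mult; [now apply qpoch_Clim | exact hF1].
Qed.

(** * A summation method beyond the disc of convergence *)

(** The series with partial sums S_N - z S_(N-1), where S_N are those of u. *)
Definition lag (z : C) (u : nat -> C) (n : nat) : C :=
  match n with
  | O => u O
  | S k => u (S k) - z * u k
  end.

(** A Norlund mean. On a convergent series it returns the sum
    ([is_norlund_sum_series]), and it annihilates the oscillation of a multiple of z^N
    in the partial sums, which is the only obstruction to the convergence of a
    series z^n g_n with g of geometric variation and |z| r < 1. It thus plays
    the part of analytic continuation in z to the larger disc. *)
Definition is_norlund_sum (z : C) (u : nat -> C) (s : C) : Prop :=
  is_Cseries (lag z u) ((1 - z) * s).

Lemma csum_lag (z : C) (u : nat -> C) (N : nat) :
  csum (lag z u) (S N) = csum u (S N) - z * csum u N.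
Proof.
  induction N as [|N IH].
  - rewrite !csum_S, !csum_0. simpl. ring.
  - rewrite csum_S, IH, (csum_S u (S N)). rewrite (csum_S u N). simpl. ring.
Qed.

Lemma is_norlund_sum_unique (z : C) (u : nat -> C) (s t : C) :
  1 - z <> 0 -> is_norlund_sum z u s -> is_norlund_sum z u t -> s = t.
Proof.
  intros hz hs ht. pose proof (is_Cseries_unique _ _ _ hs ht) as h.
  replace s with (/ (1 - z) * ((1 - z) * s)) by (field; exact hz).
  rewrite h. field. exact hz.
Qed.

Lemma is_norlund_sum_lin (z c d : C) (u v : nat -> C) (s t : C) :
  is_norlund_sum z u s -> is_norlund_sum z v t ->
  is_norlund_sum z (fun n => c * u n + d * v n) (c * s + d * t).
Proof.
  intros hs ht. unfold is_norlund_sum.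
  replace ((1 - z) * (c * s + d * t))
    with (c * ((1 - z) * s) + d * ((1 - z) * t)) by ring.
  eapply is_series_ext; [| exact (is_Cseries_lin c d _ _ _ _ hs ht)].
  intros [|n]; simpl; ring.
Qed.

Lemma is_norlund_sum_series (z : C) (u : nat -> C) (s : C) :
  is_Cseries u s -> is_norlund_sum z u s.
Proof.
  intro h. apply is_Cseries_Clim in h. apply is_Cseries_Clim, Clim_incr.
  apply Clim_ext with (fun N => csum u (S N) + - z * csum u N).
  - intro N. rewrite csum_lag. ring.
  - replace ((1 - z) * s) with (s + - z * s) by ring.
    apply Clim_plus; [now apply Clim_incr | now apply Clim_scal].
Qed.

(** The lagged terms are z^(n+1) (g_(n+1) - g_n), of order (|z| r)^n. *)
Lemma lag_dominated {I : Type} (z : C) (r : R) (g : I -> nat -> C) :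
  (0 < r)%R -> geovar r g ->
  exists M, forall i n,
    (Cmod (lag z (fun n => (Cpow z n * g i n)%C) n) <= M * (Cmod z * r) ^ n)%R.
Proof.
  intros hr [M hM]. exists (Rmax M (M / r)). intros i [|n].
  - simpl. rewrite Cmult_1_l, Rmult_1_r.
    eapply Rle_trans; [apply hM | apply Rmax_l].
  - change (lag z (fun k => z ^ k * g i k) (S n))
      with (z ^ S n * g i (S n) - z * (z ^ n * g i n)).
    replace (z ^ S n * g i (S n) - z * (z ^ n * g i n))
      with (z ^ S n * (g i (S n) - g i n)) by (rewrite Cpow_S; ring).
    rewrite Cmod_mult, Cmod_pow.
    assert (0 <= Cmod z ^ S n)%R by apply pow_le, Cmod_ge_0.
    assert (0 <= r ^ S n)%R by (apply pow_le; lra).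
    apply Rle_trans with (M / r * (Cmod z * r) ^ S n)%R.
    + rewrite Rpow_mult_distr.
      replace (M / r * (Cmod z ^ S n * r ^ S n))%R
        with (Cmod z ^ S n * (M * r ^ n))%R by (simpl; field; lra).
      apply Rmult_le_compat_l; [assumption | apply hM].
    + apply Rmult_le_compat_r; [| apply Rmax_r].
      rewrite Rpow_mult_distr. now apply Rmult_le_pos.
Qed.

(** A telescoping sum whose boundary term is z^(N+1) g_N has sum zero even
    when the boundary term does not tend to zero. *)
Lemma is_norlund_sum_telescope (z : C) (r : R) (u g : nat -> C) :
  (0 < r)%R -> (Cmod z * r < 1)%R -> geovar r (fun (_ : unit) n => g n) ->
  (forall N, csum u N = Cpow z (S N) * g N) -> is_norlund_sum z u 0.
Proof.
  intros hr hzr [M hM] hu. apply is_Cseries_Clim, Clim_incr.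
  pose proof (Cmod_ge_0 z) as hz.
  apply Clim_squeeze with (fun N => (Cmod z ^ 2 * M * (Cmod z * r) ^ N)%R).
  - intro N. rewrite csum_lag, !hu.
    replace (z ^ S (S N) * g (S N) - z * (z ^ S N * g N) - (1 - z) * 0)
      with (z ^ S (S N) * (g (S N) - g N)) by (rewrite !Cpow_S; ring).
    rewrite Cmod_mult, Cmod_pow, Rpow_mult_distr.
    replace (Cmod z ^ 2 * M * (Cmod z ^ N * r ^ N))%R
      with (Cmod z ^ S (S N) * (M * r ^ N))%R by (simpl; ring).
    apply Rmult_le_compat_l; [now apply pow_le | apply (hM tt)].
  - replace (Finite 0) with (Finite (Cmod z ^ 2 * M * 0)) by (f_equal; ring).
    apply is_lim_seq_mult'; [apply is_lim_seq_const |].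
    apply is_lim_seq_geom. rewrite Rabs_pos_eq; [exact hzr |].
    apply Rmult_le_pos; lra.
Qed.

(** * The Bailey-Daum summation *)

Lemma ratio_neq1 (b q : C) : b <> 0 -> q + b <> 0 -> 1 - - (q / b) <> 0.
Proof.
  intros hb hqb e. apply hqb.
  replace (q + b) with (b * (1 - - (q / b))) by (field; exact hb).
  rewrite e. ring.
Qed.

Lemma ratio_mul_lt1 (b q : C) :
  b <> 0 -> (Cmod (Cpow q 2 / b) < 1)%R -> (Cmod (- (q / b) * q) < 1)%R.
Proof.
  intros hb h.
  replace (- (q / b) * q) with (- (q ^ 2 / b)) by (simpl; field; exact hb).
  now rewrite Cmod_opp.
Qed.

(** The first factor is 1 + q/b, and q + b <> 0; the others are nonzero because
    |q^2/b| < 1. *)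
Lemma ratio_qpoch_inf_neq0 (b q : C) :
  b <> 0 -> q + b <> 0 -> (Cmod q < 1)%R -> (Cmod (Cpow q 2 / b) < 1)%R ->
  qpoch_inf (- (q / b)) q <> 0.
Proof.
  intros hb hqb hq h. rewrite qpoch_inf_Sl by exact hq.
  apply Cmult_neq_0; [now apply ratio_neq1 |].
  apply qpoch_inf_neq0; trivial. intro k.
  apply one_minus_geom_neq0; trivial. now apply ratio_mul_lt1.
Qed.

(** The terms of 2phi1(A, b; Aq/b; q, -q/b), with the power in front so that
    they have the shape z^n g_n. *)
Definition bailey_daum_term (A b q : C) (n : nat) : C :=
  Cpow (- (q / b)) n *
  (qpoch A q n * qpoch b q n * (/ qpoch q q n * / qpoch (A * q / b) q n)).

(** Expressing the series for A q^2 over the factorials (Aq;q) and (Aq/b;q)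
    puts both sides of the contiguous relation over a common base, without
    ever dividing by 1 - A or 1 - Aq, which may vanish. *)
Lemma bailey_daum_shifted_term (A b q : C) (n : nat) :
  b <> 0 -> (Cmod q < 1)%R -> (forall k, 1 - A * q / b * Cpow q k <> 0) ->
  (1 - A * q) * (1 - A * Cpow q 2 / Cpow b 2)
    / ((1 - A * q / b) * (1 - A * q / b * q))
    * bailey_daum_term (A * Cpow q 2) b q n
  = (1 - A * Cpow q 2 / Cpow b 2) *
    (Cpow (- (q / b)) n * (qpoch (A * q) q (S n) * qpoch b q n *
    (/ qpoch q q n * / qpoch (A * q / b) q (S (S n))))).
Proof.
  intros hb hq hu.
  assert (hQ : qpoch q q n <> 0)
    by (apply qpoch_neq0; intro k; now apply one_minus_geom_neq0).
  unfold bailey_daum_term. rewrite (qpoch_Sl (A * q)), (qpoch_Sl (A * q / b)), qpoch_Sl.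
  replace (A * q ^ 2) with (A * q * q) by (simpl; ring).
  replace (A * q * q * q / b) with (A * q / b * q * q) by (field; exact hb).
  pose proof (hu O) as h0. pose proof (hu 1%nat) as h1.
  rewrite Cpow_1_r in h1. simpl in h0. rewrite Cmult_1_r in h0.
  assert (hU : qpoch (A * q / b * q * q) q n <> 0).
  { apply qpoch_neq0. intro k. specialize (hu (2 + k)%nat).
    rewrite Cpow_add_r in hu.
    replace (A * q / b * q * q * q ^ k) with (A * q / b * (q ^ 2 * q ^ k))
      by (simpl; ring). exact hu. }
  set (u := A * q / b) in *. set (P := qpoch (A * q * q) q n).
  set (U := qpoch (u * q * q) q n) in *. set (Z := Cpow (- (q / b)) n).
  field. repeat split; assumption.
Qed.

(** The contiguous relation A -> A q^2, summed by the q-Zeilberger method: the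
    combination of the two terms is the increment in n of
    A (1 - q/b) (Aq;q)_(n-1) (b;q)_n / ((q;q)_(n-1) (Aq/b;q)_(n+1)) z^n. *)
Lemma bailey_daum_telescope (A b q : C) (N : nat) :
  q <> 0 -> b <> 0 -> (Cmod q < 1)%R ->
  (forall k, 1 - A * q / b * Cpow q k <> 0) ->
  csum (fun n => 1 * bailey_daum_term A b q n +
    - ((1 - A * q) * (1 - A * Cpow q 2 / Cpow b 2)
       / ((1 - A * q / b) * (1 - A * q / b * q)))
      * bailey_daum_term (A * Cpow q 2) b q n) N
  = Cpow (- (q / b)) (S N) *
    (A * (1 - q / b) * (qpoch (A * q) q N * qpoch b q (S N) *
      (/ qpoch q q N * / qpoch (A * q / b) q (S (S N))))).
Proof.
  intros hq0 hb hq hu.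
  assert (hqq : forall k, 1 - q * Cpow q k <> 0) by (intro k; now apply one_minus_geom_neq0).
  pose proof (fun n => bailey_daum_shifted_term A b q n hb hq hu) as hsh.
  set (R := _ / _) in hsh |- *.
  assert (hterm : forall n,
    1 * bailey_daum_term A b q n + - R * bailey_daum_term (A * Cpow q 2) b q n
    = bailey_daum_term A b q n - R * bailey_daum_term (A * Cpow q 2) b q n)
    by (intro; ring).
  induction N as [|N IH].
  - rewrite csum_0, hterm, hsh. unfold bailey_daum_term.
    pose proof (hu O) as h0. pose proof (hu 1%nat) as h1. clear - h0 h1 hq0 hb.
    remember (A * q / b) as u eqn:Eu.
    assert (EA : A = u * b / q) by (rewrite Eu; field; now split).
    clear Eu. subst A. simpl in *. rewrite !Cmult_1_r in *.
    field. repeat split; assumption.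
  - rewrite csum_S, IH, hterm, hsh. unfold bailey_daum_term.
    pose proof (hu N) as h0. pose proof (hu (S N)) as h1.
    pose proof (hu (S (S N))) as h2. pose proof (hqq N) as h3.
    pose proof (qpoch_neq0 _ _ N hu) as hU. pose proof (qpoch_neq0 _ _ N hqq) as hQ.
    rewrite (qpoch_Sl A).
    simpl qpoch. rewrite !Cpow_S in *.
    clear - h0 h1 h2 h3 hU hQ hq0 hb.
    set (P := qpoch (A * q) q N). set (B := qpoch b q N).
    set (Q := qpoch q q N) in *. set (U := qpoch (A * q / b) q N) in *.
    clearbody U.
    (* With u as the parameter the poles are visibly 1 - u q^k. *)
    remember (A * q / b) as u eqn:Eu.
    assert (EA : A = u * b / q) by (rewrite Eu; field; now split).
    clear Eu. clearbody P. subst A. set (x := Cpow q N) in *.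
    set (Z := Cpow _ N). clearbody x Z B Q. simpl Cpow.
    field. repeat split; assumption.
Qed.

Lemma bailey_daum_geovar (A b q : C) :
  (Cmod q < 1)%R -> (forall k, 1 - A * q / b * Cpow q k <> 0) ->
  geovar (Cmod q) (fun m n =>
    qpoch (A * Cpow (Cpow q 2) m) q n * qpoch b q n *
    (/ qpoch q q n * / qpoch (A * Cpow (Cpow q 2) m * q / b) q n)).
Proof.
  intros hq hu. pose proof (Cmod_ge_0 q) as hq0.
  repeat apply geovar_mult; trivial.
  - apply qpoch_geovar with (Cmod A); trivial. intro m.
    rewrite Cmod_mult, !Cmod_pow. rewrite <- (Rmult_1_r (Cmod A)) at 2.
    apply Rmult_le_compat_l; [apply Cmod_ge_0 |].
    rewrite <- pow_mult, <- (pow1 (2 * m)). apply pow_incr. lra.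
  - now apply geovar_qpoch.
  - apply geovar_qpoch_inv; trivial. intro k. now apply one_minus_geom_neq0.
  - apply geovar_ext with (fun m n => / qpoch (A * q / b * Cpow q (2 * m)) q n).
    + intros m n. rewrite Cpow_mult_r. f_equal. f_equal. unfold Cdiv. ring.
    + now apply qpoch_inv_geovar.
Qed.

Lemma bailey_daum_boundary_geovar (A b q : C) :
  (Cmod q < 1)%R -> (forall k, 1 - A * q / b * Cpow q k <> 0) ->
  geovar (Cmod q) (fun (_ : unit) N =>
    A * (1 - q / b) * (qpoch (A * q) q N * qpoch b q (S N) *
      (/ qpoch q q N * / qpoch (A * q / b) q (S (S N))))).
Proof.
  intros hq hu. pose proof (Cmod_ge_0 q) as hq0.
  assert (hr : (0 <= Cmod q < 1)%R) by (now split).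
  apply geovar_mult; trivial.
  { exists (Rmax (Cmod (A * (1 - q / b))) 0). intros _ n. split; [apply Rmax_l |].
    replace (A * (1 - q / b) - A * (1 - q / b)) with (RtoC 0) by ring.
    rewrite Cmod_0. apply Rmult_le_pos; [apply Rmax_r | now apply pow_le]. }
  apply geovar_mult; trivial; apply geovar_mult; trivial.
  - now apply geovar_qpoch.
  - apply (geovar_incr _ (fun _ => qpoch b q)); trivial. now apply geovar_qpoch.
  - apply geovar_qpoch_inv; trivial. intro k. now apply one_minus_geom_neq0.
  - apply (geovar_incr _ (fun _ n => / qpoch (A * q / b) q (S n))); trivial.
    apply (geovar_incr _ (fun _ n => / qpoch (A * q / b) q n)); trivial.
    now apply geovar_qpoch_inv.
Qed.

(** At A = 0 the lagged terms are exactly those of the q-binomial series with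
    parameter b/q at -q^2/b, a point of the unit disc. *)
Lemma bailey_daum_at_0 (b q : C) :
  q <> 0 -> b <> 0 -> q + b <> 0 -> (Cmod q < 1)%R ->
  (Cmod (Cpow q 2 / b) < 1)%R ->
  is_norlund_sum (- (q / b)) (bailey_daum_term 0 b q)
    (qpoch_inf (- q) q / qpoch_inf (- (q / b)) q).
Proof.
  intros hq0 hb hqb hq hz.
  set (z := - (q / b)).
  assert (hzq : (Cmod (z * q) < 1)%R) by now apply ratio_mul_lt1.
  assert (hz1 : 1 - z <> 0) by now apply ratio_neq1.
  destruct (q_binomial (b / q) q (z * q) hq hzq) as [s [hs hprod]].
  unfold is_norlund_sum. rewrite (qpoch_inf_Sl z) by exact hq.
  assert (hinf : qpoch_inf (z * q) q <> 0)
    by (apply qpoch_inf_neq0; trivial; intro k; now apply one_minus_geom_neq0).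
  replace (b / q * (z * q)) with (- q) in hprod
    by (unfold z; field; now split).
  assert (Es : s = (1 - z) * (qpoch_inf (- q) q / ((1 - z) * qpoch_inf (z * q) q)))
    by (rewrite <- hprod; field; now split).
  rewrite <- Es. apply is_series_ext with (2 := hs).
  intros [|n]; unfold qbin_term, lag, bailey_daum_term.
  - simpl. field.
  - assert (hqq : forall k, 1 - q * Cpow q k <> 0)
      by (intro k; now apply one_minus_geom_neq0).
    pose proof (qpoch_neq0 q q n hqq). pose proof (hqq n).
    replace (0 * q / b) with (RtoC 0) by (field; exact hb).
    rewrite !qpoch_0_l, (qpoch_Sl (b / q)).
    replace (b / q * q) with b by (field; exact hq0).
    fold z. rewrite Cpow_mult_l, !Cpow_S. simpl.
    set (B := qpoch b q n). set (x := Cpow q n) in *. set (Z := Cpow z n).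
    field. repeat split; assumption.
Qed.

(** The contiguous relation, iterated m times, expresses the sum at A by the sum
    at A q^(2m) times finite products in base q^2; as m grows these become the
    infinite products, and the remaining sum tends to its value at A = 0. When
    |q/b| < 1 the conclusion is the ordinary sum; the weaker |q^2/b| < 1 is what
    the generalized sum is for. *)
Lemma bailey_daum (A b q : C) :
  q <> 0 -> b <> 0 -> q + b <> 0 -> (Cmod q < 1)%R ->
  (Cmod (Cpow q 2 / b) < 1)%R -> (forall k, 1 - A * q / b * Cpow q k <> 0) ->
  is_norlund_sum (- (q / b)) (bailey_daum_term A b q)
    (qpoch_inf (- q) q / (qpoch_inf (- (q / b)) q * qpoch_inf (A * q / b) q)
     * qpoch_inf (A * q) (Cpow q 2)
     * qpoch_inf (A * Cpow q 2 / Cpow b 2) (Cpow q 2)).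
Proof.
  intros hq0 hb hqb hq hzb hu.
  set (z := - (q / b)).
  assert (hqp : (0 < Cmod q)%R) by now apply Cmod_gt_0.
  assert (hzq : (0 <= Cmod z * Cmod q < 1)%R).
  { rewrite <- Cmod_mult. split; [apply Cmod_ge_0 |]. now apply ratio_mul_lt1. }
  assert (hz1 : 1 - z <> 0) by now apply ratio_neq1.
  assert (hq2 : (Cmod (q ^ 2) < 1)%R) by (rewrite Cmod_pow; simpl; nra).
  set (a := fun m => A * Cpow (Cpow q 2) m).
  assert (ha : Clim a 0).
  { replace (RtoC 0) with (A * 0) by ring. apply Clim_scal. now apply Cpow_Clim. }
  assert (hum : forall m k, 1 - a m * q / b * Cpow q k <> 0).
  { intros m k. specialize (hu (2 * m + k)%nat).
    rewrite Cpow_add_r, Cpow_mult_r in hu. unfold a.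
    replace (A * (q ^ 2) ^ m * q / b * q ^ k)
      with (A * q / b * ((q ^ 2) ^ m * q ^ k)) by (unfold Cdiv; ring). exact hu. }
  pose proof (bailey_daum_geovar A b q hq hu) as hgeo.
  destruct (lag_dominated z (Cmod q) _ hqp hgeo) as [M hM].
  set (F := fun m => Cseries (lag z (bailey_daum_term (a m) b q))).
  assert (hF : forall m, is_Cseries (lag z (bailey_daum_term (a m) b q)) (F m)).
  { intro m. exact (dominated_series M _ _ hzq (hM m)). }
  set (L := fun m => / (1 - z) * F m).
  assert (hL : forall m, is_norlund_sum z (bailey_daum_term (a m) b q) (L m)).
  { intro m. unfold is_norlund_sum, L.
    replace ((1 - z) * (/ (1 - z) * F m)) with (F m) by (field; exact hz1).
    apply hF. }
  set (L0 := qpoch_inf (- q) q / qpoch_inf z q).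
  assert (hL0 : Clim L L0).
  { pose proof (bailey_daum_at_0 b q hq0 hb hqb hq hzb) as h0. fold z L0 in h0.
    replace L0 with (/ (1 - z) * ((1 - z) * L0)) by (field; exact hz1).
    apply Clim_scal.
    apply (Tannery M _ (fun m => lag z (bailey_daum_term (a m) b q))
             (lag z (bailey_daum_term 0 b q)) F _ hzq hM);
      [| exact hF | exact h0].
    assert (hbd : forall n,
      Clim (fun m => bailey_daum_term (a m) b q n) (bailey_daum_term 0 b q n)).
    { intro n. unfold bailey_daum_term. apply Clim_scal, Clim_mult; apply Clim_mult;
        try apply Clim_const.
      - now apply qpoch_continuous.
      - destruct (qpoch_inv_geovar (A * q / b) q (fun m => (2 * m)%nat) hq hu)
          as [B hB].
        apply Clim_inv with B.
        + intro m. apply qpoch_neq0, hum.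
        + replace (0 * q / b) with (RtoC 0) by (field; exact hb).
          rewrite qpoch_0_l. intro e. injection e. lra.
        + intro m. replace (a m * q / b) with (A * q / b * q ^ (2 * m)).
          * apply hB.
          * unfold a. rewrite Cpow_mult_r. unfold Cdiv. ring.
        + apply (qpoch_continuous (fun m => a m * q / b)).
          apply Clim_ext with (fun m => q / b * a m);
            [intro m; unfold Cdiv; ring |].
          replace (0 * q / b) with (q / b * 0) by (unfold Cdiv; ring).
          now apply Clim_scal. }
    intros [|n]; simpl lag; [apply hbd |].
    apply Clim_ext with
      (fun m => bailey_daum_term (a m) b q (S n) + - z * bailey_daum_term (a m) b q n);
      [intro m; ring |].
    replace (bailey_daum_term 0 b q (S n) - z * bailey_daum_term 0 b q n)
      with (bailey_daum_term 0 b q (S n) + - z * bailey_daum_term 0 b q n) by ring.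
    apply Clim_plus; [| apply Clim_scal]; apply hbd. }
  (* The contiguous relation: the telescoping boundary sums to zero. *)
  assert (hrec : forall m,
    (1 - a m * q / b) * (1 - a m * q / b * q) * L m
    = (1 - a m * q) * (1 - a m * Cpow q 2 / Cpow b 2) * L (S m)).
  { intro m.
    pose proof (hum m O) as h0. pose proof (hum m 1%nat) as h1.
    rewrite Cpow_1_r in h1. simpl in h0. rewrite Cmult_1_r in h0.
    pose proof (hL (S m)) as h.
    replace (a (S m)) with (a m * Cpow q 2) in h by (unfold a; simpl; ring).
    set (R := (1 - a m * q) * (1 - a m * Cpow q 2 / Cpow b 2)
              / ((1 - a m * q / b) * (1 - a m * q / b * q))).
    assert (h' := is_norlund_sum_lin z 1 (- R) _ _ _ _ (hL m) h).
    assert (h2 := is_norlund_sum_telescope z (Cmod q) _ _ hqp (proj2 hzq)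
                    (bailey_daum_boundary_geovar (a m) b q hq (hum m))
                    (fun N => bailey_daum_telescope (a m) b q N hq0 hb hq (hum m))).
    pose proof (is_norlund_sum_unique z _ _ _ hz1 h' h2) as e.
    replace (L m) with (R * L (S m)).
    - unfold R. clear - h0 h1 hb. set (u := a m * q / b) in *.
      clearbody u a. field. repeat split; assumption.
    - replace (L m) with ((1 * L m + - R * L (S m)) + R * L (S m)) by ring.
      rewrite e. ring. }
  assert (hprod : forall m, qpoch (A * q / b) q (2 * m) * L O
    = qpoch (A * q) (Cpow q 2) m
      * qpoch (A * Cpow q 2 / Cpow b 2) (Cpow q 2) m * L m).
  { induction m as [|m IH]; [simpl; ring |].
    replace (2 * S m)%nat with (S (S (2 * m))) by lia.
    pose proof (Cpow_mult_r q 2 m) as ex.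
    generalize dependent (2 * m)%nat. intros n IH ex.
    specialize (hrec m). unfold a in hrec.
    set (x := Cpow (Cpow q 2) m) in *.
    change (qpoch (A * q / b) q (S (S n)))
      with (qpoch (A * q / b) q n * (1 - A * q / b * q ^ n)
            * (1 - A * q / b * (q * q ^ n))).
    change (qpoch ?y (q ^ 2) (S m)) with (qpoch y (q ^ 2) m * (1 - y * x)).
    rewrite ex.
    replace (qpoch (A * q / b) q n * (1 - A * q / b * x)
             * (1 - A * q / b * (q * x)) * L O)
      with ((qpoch (A * q / b) q n * L O) * ((1 - A * q / b * x)
             * (1 - A * q / b * (q * x)))) by ring.
    rewrite IH.
    replace (A * x * q / b) with (A * q / b * x) in hrec by (unfold Cdiv; ring).
    replace (A * x * q) with (A * q * x) in hrec by ring.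
    replace (A * x * q ^ 2 / b ^ 2) with (A * q ^ 2 / b ^ 2 * x) in hrec
      by (unfold Cdiv; ring).
    set (P := qpoch _ _ m). set (P' := qpoch _ _ m).
    replace (P * P' * L m * ((1 - A * q / b * x) * (1 - A * q / b * (q * x))))
      with (P * P' * ((1 - A * q / b * x) * (1 - A * q / b * x * q) * L m)) by ring.
    rewrite hrec. ring. }
  assert (hinf : qpoch_inf (A * q / b) q * L O
    = qpoch_inf (A * q) (Cpow q 2)
      * qpoch_inf (A * Cpow q 2 / Cpow b 2) (Cpow q 2) * L0).
  { apply (Clim_unique (fun m => qpoch (A * q / b) q (2 * m) * L O)).
    - apply Clim_mult; [| apply Clim_const].
      apply (Clim_subseq (qpoch (A * q / b) q) _ (fun m => (2 * m)%nat));
        [lia | now apply qpoch_Clim].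
    - eapply Clim_ext; [intro m; symmetry; apply hprod |].
      apply Clim_mult; [| exact hL0].
      apply Clim_mult; now apply qpoch_Clim. }
  pose proof (qpoch_inf_neq0 _ _ hq hu) as hU.
  assert (hz0 : qpoch_inf z q <> 0) by now apply ratio_qpoch_inf_neq0.
  specialize (hL O). unfold a in hL at 1. simpl in hL. rewrite Cmult_1_r in hL.
  replace (_ * _ * _) with (L O); [exact hL |].
  replace (L O) with (/ qpoch_inf (A * q / b) q * (qpoch_inf (A * q / b) q * L O))
    by (field; exact hU).
  rewrite hinf. unfold L0. field. now split.
Qed.

(** * Reduction of the 4phi3 series *)

(** Turns the absence of poles into the form in which field asks for it. *)
Lemma clear_denominator (b v : C) : b <> 0 -> 1 - v / b <> 0 -> b - v <> 0.
Proof.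
  intros hb h e. apply h. replace (1 - v / b) with ((b - v) / b) by (field; exact hb).
  rewrite e. unfold Cdiv. ring.
Qed.

Definition phi_term (a b q : C) : nat -> C :=
  phi43_term a b ((a + b) / (q + b)) ((a + b) * q / (1 + b))
    (a * q / b) ((a + b) * Cpow q 2 / (q + b)) ((a + b) / (1 + b))
    q (- (Cpow q 2 / b)).

(** With d = (a+b)/(1+b), the factors (c;q)_n / (c q^2;q)_n and
    (dq;q)_n / (d;q)_n are rational functions of q^n. The factorials are
    shifted so as to avoid any division by 1 - c or 1 - cq, which may vanish. *)
Lemma phi_term_S (a b q c : C) (n : nat) :
  q <> 0 -> b <> 0 -> 1 + b <> 0 -> q + b <> 0 -> (Cmod q < 1)%R ->
  c = (a + b) / (q + b) ->
  (forall k, 1 - a * q / b * Cpow q k <> 0) ->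
  (forall k, 1 - c * q * q * Cpow q k <> 0) ->
  (forall k, 1 - (a + b) / (1 + b) * Cpow q k <> 0) ->
  phi_term a b q (S n) =
  Cpow (- (q / b)) (S n) * (Cpow q (S n) *
  (qpoch (a * q) q n * qpoch b q (S n) * (1 - c) * qpoch (c * q) q n *
   (1 + b - (a + b) * Cpow q (S n)) /
   (qpoch q q (S n) * qpoch (a * q / b) q (S n) * qpoch (c * q * q) q (S n)))).
Proof.
  intros hq0 hb h1b hqb hq Ec hu hc hd.
  assert (hqq : forall k, 1 - q * Cpow q k <> 0)
    by (intro k; now apply one_minus_geom_neq0).
  pose proof (qpoch_neq0 _ _ (S n) hu) as hU.
  pose proof (qpoch_neq0 _ _ (S n) hc) as hC.
  pose proof (qpoch_neq0 _ _ (S n) hqq) as hQ.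
  pose proof (qpoch_neq0 _ _ (S n) hd) as hD.
  pose proof (hd O) as hd0. simpl in hd0. rewrite Cmult_1_r in hd0.
  unfold phi_term, phi43_term. rewrite <- Ec.
  replace ((a + b) * q ^ 2 / (q + b)) with (c * q * q)
    by (rewrite Ec; simpl; field; exact hqb).
  replace ((a + b) * q / (1 + b)) with ((a + b) / (1 + b) * q)
    by (field; exact h1b).
  pose proof (qpoch_ratio ((a + b) / (1 + b)) q (S n)) as hr.
  replace (- (q ^ 2 / b)) with (- (q / b) * q) by (simpl; field; exact hb).
  rewrite (qpoch_Sl a), (qpoch_Sl c), Cpow_mult_l.
  (* 1 - a = (1 + b)(1 - d): this absorbs the denominator 1 - d. *)
  set (d := (a + b) / (1 + b)) in *.
  assert (Ea : a = d * (1 + b) - b) by (unfold d; field; exact h1b).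
  replace (qpoch (d * q) q (S n))
    with (qpoch d q (S n) * (1 - d * q ^ S n) / (1 - d))
    by (rewrite <- hr; field; exact hd0).
  replace (1 + b - (a + b) * q ^ S n) with ((1 + b) * (1 - d * q ^ S n))
    by (rewrite Ea; ring).
  replace (1 - a) with ((1 + b) * (1 - d)) by (rewrite Ea; ring).
  clear - hU hC hQ hD hd0. clearbody d.
  set (U := qpoch _ _ (S n)) in hU |- *.
  generalize dependent (qpoch d q (S n)).
  generalize dependent (qpoch q q (S n)).
  generalize dependent (qpoch (c * q * q) q (S n)).
  intros. field. repeat split; assumption.
Qed.

(** Up to a constant, the 4phi3 series is the Bailey-Daum series at A = aq plus a
    telescoping sum. By the partial fractions
    (1+b-(a+b)x)/(D(x) D(qx)) = (1/D(x) + b/D(qx))/(q+b), D(x) = q+b-(a+b)x,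
    one looks for a boundary term with the single denominator D(q^n); matching
    the lowest coefficient in x fixes the constant, and the rest is an identity. *)
Lemma phi_telescope (a b q c : C) (N : nat) :
  q <> 0 -> b <> 0 -> 1 + b <> 0 -> q + b <> 0 -> (Cmod q < 1)%R ->
  c = (a + b) / (q + b) ->
  (forall k, 1 - a * q / b * Cpow q k <> 0) ->
  (forall k, 1 - c * q * q * Cpow q k <> 0) ->
  (forall k, 1 - (a + b) / (1 + b) * Cpow q k <> 0) ->
  csum (fun n => 1 * phi_term a b q n +
    - ((q - a * q + b - b * q) / b / (1 - a * q / b))
      * bailey_daum_term (a * q) b q n) N
  = Cpow (- (q / b)) (S N) *
    (qpoch (a * q) q N * qpoch b q (S N) * qpoch (c * q) q N *
     (/ qpoch q q N * / qpoch (a * q / b) q (S N) * / qpoch (c * q * q) q N)).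
Proof.
  intros hq0 hb h1b hqb hq Ec hu hc hd.
  assert (hqq : forall k, 1 - q * Cpow q k <> 0)
    by (intro k; now apply one_minus_geom_neq0).
  pose proof (fun n => phi_term_S a b q c n hq0 hb h1b hqb hq Ec hu hc hd) as hS.
  assert (Ea : a = c * (q + b) - b) by (rewrite Ec; field; exact hqb).
  pose proof (hu O) as hu0. simpl in hu0. rewrite Cmult_1_r in hu0.
  assert (hbd : forall n,
    (q - a * q + b - b * q) / b / (1 - a * q / b) * bailey_daum_term (a * q) b q n
    = (q + b) / b * (Cpow (- (q / b)) n * (qpoch (a * q) q n * qpoch b q n
      * (1 - c * (q * Cpow q n)) * qpoch (c * q) q n
      * (/ qpoch q q n * / qpoch (a * q / b) q (S n) * / qpoch (c * q * q) q n)))).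
  { intro n. unfold bailey_daum_term.
    pose proof (qpoch_ratio (c * q) q n) as hr.
    pose proof (qpoch_neq0 _ _ (S n) hu) as hU.
    pose proof (qpoch_neq0 _ _ n hc) as hC.
    pose proof (qpoch_neq0 _ _ n hqq) as hQ.
    rewrite qpoch_Sl in hU |- *.
    assert (hU' : qpoch (a * q / b * q) q n <> 0).
    { intro e. apply hU. rewrite e. ring. }
    replace (a * q * q / b) with (a * q / b * q) by (field; exact hb).
    replace (q - a * q + b - b * q) with ((q + b) * (1 - c * q))
      by (rewrite Ea; ring).
    set (P := qpoch (a * q) q n). set (B := qpoch b q n).
    set (K := qpoch (c * q) q n) in *. set (K' := qpoch (c * q * q) q n) in *.
    replace (P * B * (1 - c * (q * q ^ n)) * K)
      with (P * B * (K * (1 - c * q * q ^ n))) by ring.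
    rewrite <- hr.
    clear - hU' hC hQ hu0 hb.
    set (U := qpoch _ _ n) in hU' |- *. set (Q := qpoch q q n) in *.
    set (u := a * q / b) in *. set (Z := Cpow _ n).
    clearbody P B K' U Q u Z. field. repeat split; assumption. }
  assert (hterm : forall n, 1 * phi_term a b q n +
    - ((q - a * q + b - b * q) / b / (1 - a * q / b)) * bailey_daum_term (a * q) b q n
    = phi_term a b q n -
      (q - a * q + b - b * q) / b / (1 - a * q / b) * bailey_daum_term (a * q) b q n)
    by (intro; ring).
  induction N as [|N IH].
  - rewrite csum_0, hterm, hbd. unfold phi_term, phi43_term.
    simpl. rewrite !Cmult_1_r. clear - Ea hb hu0.
    set (u := a * q / b) in *.
    assert (Eu : u = (c * (q + b) - b) * q / b) by (unfold u; now rewrite Ea).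
    clearbody u. clear Ea. subst u.
    apply clear_denominator in hu0; [| exact hb]. field. now split.
  - rewrite csum_S, IH, hterm, hbd, hS.
    pose proof (hu N) as h0. pose proof (hu (S N)) as h1.
    pose proof (hqq N) as h3. pose proof (hc N) as h4.
    pose proof (qpoch_neq0 _ _ N hu) as hU.
    pose proof (qpoch_neq0 _ _ N hqq) as hQ.
    pose proof (qpoch_neq0 _ _ N hc) as hC.
    simpl qpoch.
    clear - h0 h1 h3 h4 hU hQ hC hq0 hb Ea.
    set (P := qpoch (a * q) q N). set (B := qpoch b q N).
    set (K := qpoch (c * q) q N). set (K' := qpoch (c * q * q) q N) in *.
    set (Q := qpoch q q N) in *. set (U := qpoch (a * q / b) q N) in *.
    clearbody P B K K' Q U.
    rewrite !Cpow_S in *. set (x := Cpow q N) in *. set (Z := Cpow _ N).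
    clearbody x Z. subst a.
    replace (1 - (c * (q + b) - b) * q / b * (q * x))
      with (1 - (c * (q + b) - b) * q * (q * x) / b) in h1 by (unfold Cdiv; ring).
    replace (1 - (c * (q + b) - b) * q / b * x)
      with (1 - (c * (q + b) - b) * q * x / b) in h0 by (unfold Cdiv; ring).
    apply clear_denominator in h0, h1; try exact hb.
    field. repeat split; assumption.
Qed.

Lemma phi_term_dominated (a b q c : C) :
  q <> 0 -> b <> 0 -> q + b <> 0 -> 1 + b <> 0 -> (Cmod q < 1)%R ->
  c = (a + b) / (q + b) ->
  (forall k, 1 - a * q / b * Cpow q k <> 0) ->
  (forall k, 1 - c * q * q * Cpow q k <> 0) ->
  (forall k, 1 - (a + b) / (1 + b) * Cpow q k <> 0) ->
  exists M, forall n, (Cmod (phi_term a b q n) <= M * Cmod (Cpow q 2 / b) ^ n)%R.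
Proof.
  intros hq0 hb hqb h1b hq Ec hu hc hd.
  pose proof (Cmod_ge_0 q) as hq'.
  assert (hqq : forall k, 1 - q * Cpow q k <> 0)
    by (intro k; now apply one_minus_geom_neq0).
  assert (hgeo : geovar (Cmod q) (fun (_ : unit) n =>
    qpoch a q n * qpoch b q n * qpoch c q n * qpoch ((a + b) * q / (1 + b)) q n *
    (/ qpoch q q n * / qpoch (a * q / b) q n * / qpoch (c * q * q) q n
     * / qpoch ((a + b) / (1 + b)) q n))).
  { repeat apply geovar_mult; trivial;
      first [now apply geovar_qpoch | now apply geovar_qpoch_inv]. }
  destruct hgeo as [M hM]. exists M. intro n.
  destruct (hM tt n) as [h _].
  unfold phi_term, phi43_term. rewrite <- Ec.
  replace ((a + b) * q ^ 2 / (q + b)) with (c * q * q)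
    by (rewrite Ec; simpl; field; exact hqb).
  rewrite Cmod_mult, Cmod_pow, Cmod_opp.
  apply Rmult_le_compat_r; [apply pow_le, Cmod_ge_0 |].
  eapply Rle_trans; [right | exact h]. f_equal.
  field. repeat split; now apply qpoch_neq0.
Qed.

Theorem theorem5 (q a b : C)
  (hq0 : q <> 0) (hq1 : (Cmod q < 1)%R)
  (hb0 : b <> 0) (hqb : (Cmod (Cpow q 2 / b) < 1)%R)
  (hden1 : q + b <> 0) (hden2 : 1 + b <> 0)
  (hb1 : forall k : nat, a * q / b <> / Cpow q k)
  (hb2 : forall k : nat, (a + b) * Cpow q 2 / (q + b) <> / Cpow q k)
  (hb3 : forall k : nat, (a + b) / (1 + b) <> / Cpow q k) :
  is_phi43
    a b ((a + b) / (q + b)) ((a + b) * q / (1 + b))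
    (a * q / b) ((a + b) * Cpow q 2 / (q + b)) ((a + b) / (1 + b))
    q (- (Cpow q 2 / b))
    ((q - a * q + b - b * q) / b *
     (qpoch_inf (- q) q / (qpoch_inf (- (q / b)) q * qpoch_inf (a * q / b) q)) *
     qpoch_inf (a * Cpow q 2) (Cpow q 2) *
     qpoch_inf (a * Cpow q 3 / Cpow b 2) (Cpow q 2)).
Proof.
  set (c := (a + b) / (q + b)).
  pose proof (pole_free _ _ hq0 hb1) as hu.
  pose proof (pole_free _ _ hq0 hb3) as hd.
  assert (hc : forall k, 1 - c * q * q * Cpow q k <> 0).
  { intro k. pose proof (pole_free _ _ hq0 hb2 k) as h.
    replace (c * q * q) with ((a + b) * q ^ 2 / (q + b))
      by (unfold c; simpl; field; exact hden1). exact h. }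
  assert (huq : forall k, 1 - a * q * q / b * Cpow q k <> 0).
  { intro k. specialize (hu (S k)). rewrite Cpow_S in hu.
    replace (a * q * q / b * q ^ k) with (a * q / b * (q * q ^ k))
      by (unfold Cdiv; ring). exact hu. }
  pose proof (hu O) as hu0. simpl in hu0. rewrite Cmult_1_r in hu0.
  set (z := - (q / b)).
  assert (hz1 : 1 - z <> 0) by now apply ratio_neq1.
  assert (hzq : (Cmod z * Cmod q < 1)%R).
  { rewrite <- Cmod_mult. now apply ratio_mul_lt1. }
  assert (hqp : (0 < Cmod q)%R) by now apply Cmod_gt_0.
  destruct (phi_term_dominated a b q c hq0 hb0 hden1 hden2 hq1 eq_refl hu hc hd)
    as [M hM].
  pose proof (dominated_series M _ _ (conj (Cmod_ge_0 _) hqb) hM) as hs.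
  set (s := Cseries (phi_term a b q)) in hs.
  pose proof (bailey_daum (a * q) b q hq0 hb0 hden1 hq1 hqb huq) as hbd.
  set (t := _ * _ * _) in hbd.
  set (K := (q - a * q + b - b * q) / b / (1 - a * q / b)).
  assert (hgeo : geovar (Cmod q) (fun (_ : unit) N =>
    qpoch (a * q) q N * qpoch b q (S N) * qpoch (c * q) q N *
     (/ qpoch q q N * / qpoch (a * q / b) q (S N) * / qpoch (c * q * q) q N))).
  { assert (hr : (0 <= Cmod q < 1)%R) by lra.
    assert (hqq : forall k, 1 - q * Cpow q k <> 0)
      by (intro k; now apply one_minus_geom_neq0).
    apply geovar_mult; [lra | |]; (apply geovar_mult; [lra | |]);
      try (apply geovar_mult; [lra | |]);
      try first [now apply geovar_qpoch | now apply geovar_qpoch_inv].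
    - apply (geovar_incr _ (fun _ => qpoch b q)); trivial. now apply geovar_qpoch.
    - apply (geovar_incr _ (fun _ n => / qpoch (a * q / b) q n)); trivial.
      now apply geovar_qpoch_inv. }
  assert (h0 := is_norlund_sum_telescope z (Cmod q) _ _ hqp hzq hgeo
    (fun N => phi_telescope a b q c N hq0 hb0 hden2 hden1 hq1 eq_refl hu hc hd)).
  assert (h1 := is_norlund_sum_lin z 1 (- K) _ _ _ _ (is_norlund_sum_series z _ _ hs) hbd).
  pose proof (is_norlund_sum_unique z _ _ _ hz1 h1 h0) as e.
  assert (es : s = K * t).
  { replace s with ((1 * s + - K * t) + K * t) by ring. rewrite e. ring. }
  unfold is_phi43. fold (phi_term a b q).
  assert (hinf1 : qpoch_inf (a * q / b * q) q <> 0).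
  { replace (a * q / b * q) with (a * q * q / b) by (unfold Cdiv; ring).
    now apply qpoch_inf_neq0. }
  assert (hinf2 : qpoch_inf z q <> 0) by now apply ratio_qpoch_inf_neq0.
  fold z.
  assert (et : s = (q - a * q + b - b * q) / b *
     (qpoch_inf (- q) q / (qpoch_inf z q * qpoch_inf (a * q / b) q)) *
     qpoch_inf (a * Cpow q 2) (Cpow q 2) *
     qpoch_inf (a * Cpow q 3 / Cpow b 2) (Cpow q 2)).
  { rewrite es. unfold K, t. fold z.
    rewrite (qpoch_inf_Sl (a * q / b)) by exact hq1.
    replace (a * q * q / b) with (a * q / b * q) by (unfold Cdiv; ring).
    replace (a * q * q) with (a * q ^ 2) by (simpl; ring).
    replace (a * q * q ^ 2 / b ^ 2) with (a * q ^ 3 / b ^ 2)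
      by (unfold Cdiv; simpl; ring).
    set (u := a * q / b) in *. clearbody u z. clear - hu0 hinf1 hinf2 hb0.
    set (X := qpoch_inf (u * q) q) in *. set (Y := qpoch_inf z q) in *.
    set (V := qpoch_inf (a * q ^ 2) _). set (W := qpoch_inf (a * q ^ 3 / b ^ 2) _).
    set (T := qpoch_inf (- q) q). clearbody X Y V W T.
    field. repeat split; assumption. }
  rewrite <- et. exact hs.
Qed.
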